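(* For all integers $n \geq 1$, the following expressions (polynomials in $z$ with coefficients that are Laurent polynomials in $q$) are all equal: \begin{align*} \sum_{k=0}^{n-1} \Big(\sum_{(\sigma,S)\in \mathfrak{S}^{>}_{n,k}} q^{\operatorname{inv}((\sigma,S))}\Big) z^{k} &= \sum_{k=0}^{n-1} \Big(\sum_{(\sigma,S)\in \mathfrak{S}^{>}_{n,k}} q^{\operatorname{maj}((\sigma,S))}\Big) z^{k} =\sum_{k=1}^n [k]_q!\, S_{n,k}(q)\, z^{n-k}\\ &=\sum_{\sigma \in \mathfrak{S}_{n}} q^{\operatorname{inv}(\sigma)} \prod_{j \in \operatorname{Des}(\sigma)} \left(1 + \frac{z}{q^{1 + \operatorname{inv}^{\Box, j}(\sigma)}} \right) \\ &=\sum_{\sigma \in \mathfrak{S}_{n}} q^{\operatorname{inv}(\sigma)} \prod_{j \in \operatorname{Asc}(\sigma)} \left(1 + \frac{z}{q^{\operatorname{inv}^{\Box, j+1}(\sigma)}} \right) \\ &= \sum_{\sigma \in \mathfrak{S}_{n}} q^{\operatorname{maj}(\sigma)} \prod_{j = 1}^{\operatorname{des}(\sigma)} \left(1 + \frac{z}{q^{j}} \right). \end{align*}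
   Context: $\mathfrak{S}_n$ is the set of permutations $\sigma=\sigma_1\cdots\sigma_n$ of $\{1,\dots,n\}$. For $\sigma\in\mathfrak{S}_n$: $\operatorname{Des}(\sigma)=\{i\in\{1,\dots,n-1\}:\sigma_i>\sigma_{i+1}\}$, $\operatorname{Asc}(\sigma)=\{i\in\{1,\dots,n-1\}:\sigma_i<\sigma_{i+1}\}$, $\operatorname{des}(\sigma)=|\operatorname{Des}(\sigma)|$, $\operatorname{maj}(\sigma)=\sum_{i\in\operatorname{Des}(\sigma)}i$, $\operatorname{inv}(\sigma)=|\{(i,j):1\le i<j\le n,\ \sigma_i>\sigma_j\}|$, and $\operatorname{inv}^{\Box,j}(\sigma)=|\{i: 1\le i<j,\ \sigma_i>\sigma_j\}|$. $\mathfrak{S}^{>}_{n,k}=\{(\sigma,S):\sigma\in\mathfrak{S}_n,\ S\subseteq\operatorname{Des}(\sigma),\ |S|=k\}$ (descent-starred permutations; $S$ is the set of starred positions). For $(\sigma,S)\in\mathfrak{S}^{>}_{n,k}$, $$\operatorname{inv}((\sigma,S))=\operatorname{inv}(\sigma)-\sum_{i\in S}\big(1+\operatorname{inv}^{\Box,i}(\sigma)\big),\qquad \operatorname{maj}((\sigma,S))=\operatorname{maj}(\sigma)-\sum_{i\in S}|\operatorname{Des}(\sigma)\cap\{i,i+1,\dots,n-1\}|.$$ $[k]_q=1+q+\cdots+q^{k-1}$ and $[k]_q!=[1]_q[2]_q\cdots[k]_q$. The $q$-Stirling numbers $S_{n,k}(q)$ are defined by $S_{0,0}(q)=1$, $S_{n,k}(q)=0$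 if $k<0$ or $k>n$, and $S_{n+1,k}(q)=S_{n,k-1}(q)+[k]_qS_{n,k}(q)$. *)

(* Defs.v *)
From mathcomp Require Import all_boot all_order all_fingroup all_algebra.

Set Implicit Arguments.
Unset Strict Implicit.
Unset Printing Implicit Defensive.

Import GRing.Theory.
Local Open Scope ring_scope.

(* Laurent polynomials in q are taken inside the field Q(q) of fractions of   *)
(* Z[q], into which Z[q, 1/q] embeds; z is the variable of polynomials over   *)
(* this field.                                                                *)
Notation Zq := {fraction {poly int}}.
Definition q : Zq := tofrac 'X.
Definition z : {poly Zq} := 'X.

(* Positions and letters are shifted by one: a permutation s of {0, ..., n-1} *)
(* stands for the word with sigma_(i + 1) = s i + 1, and i : 'I_n stands for  *)
(* the position i + 1.  The cyclic successor ordS i is the next position; it  *)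
(* does not wrap around when i.+1 < n.                                        *)
Section PermutationStatistics.
Variable n : nat.
Implicit Type s : 'S_n.

Definition Des s : {set 'I_n} :=
  [set i : 'I_n | (i.+1 < n)%N && (s (ordS i) < s i)%N].

Definition Asc s : {set 'I_n} :=
  [set i : 'I_n | (i.+1 < n)%N && (s i < s (ordS i))%N].

Definition des s : nat := #|Des s|.

Definition maj s : nat := (\sum_(i in Des s) i.+1)%N.

Definition ninv s : nat :=
  #|[set ij : 'I_n * 'I_n | (ij.1 < ij.2)%N && (s ij.2 < s ij.1)%N]|.

Definition ninv_box s (j : 'I_n) : nat :=
  #|[set i : 'I_n | (i < j)%N && (s j < s i)%N]|.

Definition starred (k : nat) : {set 'S_n * {set 'I_n}} :=
  [set sS : 'S_n * {set 'I_n} | (sS.2 \subset Des sS.1) && (#|sS.2| == k)].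

Definition ninv_star (sS : 'S_n * {set 'I_n}) : int :=
  (ninv sS.1)%:Z - \sum_(i in sS.2) (1 + ninv_box sS.1 i)%N%:Z.

Definition maj_star (sS : 'S_n * {set 'I_n}) : int :=
  (maj sS.1)%:Z
  - \sum_(i in sS.2) #|[set j in Des sS.1 | (i <= j)%N]|%:Z.

End PermutationStatistics.

Definition qint (k : nat) : Zq := \sum_(i < k) q ^+ i.

Definition qfact (k : nat) : Zq := \prod_(1 <= i < k.+1) qint i.

(* The values for k < 0 enter only through the case k = 0 of the recurrence;  *)
(* the vanishing for k > n is [qstirling_gt] below.                           *)
Fixpoint qstirling (n k : nat) : Zq :=
  match n with
  | 0 => if k == 0%N then 1 else 0
  | m.+1 => (if k is l.+1 then qstirling m l else 0) + qint k * qstirling m k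
  end.

Lemma qstirling_gt (n k : nat) : (n < k)%N -> qstirling n k = 0.
Proof.
elim: n k => [|n IHn] [|k] //= lt_nk.
by rewrite !IHn ?mulr0 ?addr0 // ltnW.
Qed.

(* Main.v *)
(* Each product sum, being indexed by permutations, is evaluated by adding one
   letter at a time.

   Let F_n = sum_k [k]_q! S_{n,k}(q) z^(n-k), let L be the linear functional
   x^n |-> F_n on polynomials in x, and let
     h_n = ((qx + z)^n - x^n) / ((qx + z) - x).
   The recurrence of the q-Stirling numbers gives L(h_n) = F_n for n >= 1.

   For the two sums over inversions, the letters of the Lehmer code of sigma are
   c_j = inv^{box,j}(sigma), with 0 <= c_j < j, and j is a descent if and only if
   c_j < c_(j+1).  The sums are thus transfer-matrix sums over codes, in which the
   words of length n + 1 with last code letter c contribute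
     L(x^(n-c) (qx + z)^c)                 for the product over descents,
     q^c (F_n + z L(x^c h_(n-c)))          for the product over ascents;
   summed over c, both give L(h_(n+1)).

   For the major index, inserting the largest letter in all positions of sigma
   yields a telescoping sum, and shows that the last expression satisfies
     (q - 1) F_(n+1)(z) = (q + z) q^n F_n(z/q) - (1 + z) F_n(z),
   which F_n also satisfies, term by term.

   The starred sums are the expansions of the products over descents; for maj the
   i-th descent from the right contributes the factor 1 + z/q^i. *)

Require Import Defs.
From mathcomp Require Import all_boot all_order all_fingroup all_algebra.
From mathcomp Require Import ring zify.

Set Implicit Arguments.
Unset Strict Implicit.
Unset Printing Implicit Defensive.

Import GRing.Theory.
Local Open Scope ring_scope.

(** * The umbral functional *)

Section OrderedStirling.
Variables (R : comNzRingType) (q z : R).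

(** The linear functional x^i |-> [u i]; besides [ofubini], it is applied to the columns [ostir^~ k]
    and to shifted sequences. *)
Definition umbral (u : nat -> R) (p : {poly R}) : R := \sum_(i < size p) p`_i * u i.

Lemma umbral_wide u (p : {poly R}) N : (size p <= N)%N ->
  umbral u p = \sum_(i < N) p`_i * u i.
Proof.
move=> le_pN; rewrite /umbral (big_ord_widen N (fun i => p`_i * u i)) //.
rewrite big_mkcond; apply: eq_bigr => i _.
by case: ltnP => // le_pi; rewrite nth_default ?mul0r.
Qed.

Lemma umbralD u : {morph umbral u : p r / p + r}.
Proof.
move=> p r; pose N := maxn (size p) (size r).
rewrite !(@umbral_wide _ _ N) ?leq_maxl ?leq_maxr ?size_polyD // -big_split.
by apply: eq_bigr => i _; rewrite coefD mulrDl.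
Qed.

Lemma umbralZ u a p : umbral u (a *: p) = a * umbral u p.
Proof.
rewrite !(@umbral_wide _ _ (size p)) ?size_scale_leq // big_distrr /=.
by apply: eq_bigr => i _; rewrite coefZ mulrA.
Qed.

Lemma umbral0 u : umbral u 0 = 0.
Proof. by rewrite /umbral size_poly0 big_ord0. Qed.

Lemma umbral_sum u I (r : seq I) (P : pred I) (F : I -> {poly R}) :
  umbral u (\sum_(i <- r | P i) F i) = \sum_(i <- r | P i) umbral u (F i).
Proof. exact: (big_morph _ (umbralD u) (umbral0 u)). Qed.

Lemma umbralXn u n : umbral u 'X^n = u n.
Proof.
rewrite /umbral size_polyXn big_ord_recr /= big1 ?add0r ?coefXn ?eqxx ?mul1r //.
by move=> i _; rewrite coefXn ltn_eqF ?mul0r.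
Qed.

Lemma umbralX u p : umbral u ('X * p) = umbral (fun i => u i.+1) p.
Proof.
rewrite (@umbral_wide _ _ (size p).+1).
  by rewrite big_ord_recl coefXM mul0r add0r; apply: eq_bigr => i _; rewrite coefXM.
by rewrite mulrC; apply: leq_trans (size_polyMleq _ _) _; rewrite size_polyX addn2.
Qed.

(* The polynomial h_n: the divided difference of x^n at qx + z and x. *)
Definition divdiff n : {poly R} :=
  \sum_(i < n) 'X^(n.-1 - i) * (q *: 'X + z%:P) ^+ i.

Lemma divdiffS n : divdiff n.+1 = (q *: 'X + z%:P) * divdiff n + 'X^n.
Proof.
rewrite /divdiff big_ord_recl subn0 expr0 mulr1 addrC; congr (_ + _).
rewrite big_distrr /=; apply: eq_bigr => i _.
by rewrite exprS mulrCA /bump add1n -subn1 -subnDA add1n.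
Qed.

(* ostir n k = [k]_q! S_{n,k}(q) z^(n-k); see [ostirE]. *)
Fixpoint ostir (n k : nat) : R :=
  match n, k with
  | 0, 0 => 1
  | m.+1, l.+1 => (\sum_(i < k) q ^+ i) * (z * ostir m k + ostir m l)
  | _, _ => 0
  end.

Lemma ostir_gt n k : (n < k)%N -> ostir n k = 0.
Proof.
elim: n k => [|n IHn] [|k] //= lt_nk.
by rewrite !IHn ?mulr0 ?addr0 ?mulr0 // ltnW.
Qed.

(** A refinement by k of L(h_n) = F_n, by induction on n. Let L_k send x^i to [ostir i k]. For k >=
    1 the recurrence gives L_k(x h_n) = [k]_q (z L_k(h_n) + L_(k-1)(h_n)), and 1 + q [k]_q = [k+1]_q
    does the rest. *)
Lemma ostir_divdiff n k : ostir n k.+1 = umbral (ostir^~ k) (divdiff n).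
Proof.
elim: n k => [|n IHn] k; first by rewrite /divdiff big_ord0 umbral0.
rewrite divdiffS umbralD umbralXn mulrDl umbralD -scalerAl umbralZ mul_polyC.
rewrite umbralZ -IHn umbralX /=.
(* A factor x shifts the sequence; for k = 0 both sides vanish. *)
have ->: umbral (fun i => ostir i.+1 k) (divdiff n) =
    (\sum_(i < k) q ^+ i) * (z * ostir n k.+1 + ostir n k).
  case: k => [|k]; first by rewrite big_ord0 mul0r /umbral big1 // => i _; rewrite mulr0.
  rewrite [ostir n k.+2]IHn [ostir n k.+1]IHn /umbral mulrDr !big_distrr -big_split /=.
  by apply: eq_bigr => i _ /=; ring.
rewrite big_ord_recl expr0.
under eq_bigr => i _ do rewrite lift0 exprS.
by rewrite -big_distrr /=; ring.
Qed.

(** The F_n above; at q = z = 1 it is the Fubini number, which counts ordered set partitions. *)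
Definition ofubini n : R := \sum_(k < n.+1) ostir n k.

Lemma ofubini_wide n N : (n < N)%N -> ofubini n = \sum_(k < N) ostir n k.
Proof.
move=> lt_nN; rewrite /ofubini (big_ord_widen N (ostir n)) // big_mkcond.
by apply: eq_bigr => i _; case: ltnP => // /ostir_gt.
Qed.

Lemma size_divdiff n : (size (divdiff n) <= n)%N.
Proof.
elim: n => [|n IHn]; first by rewrite /divdiff big_ord0 size_poly0.
rewrite divdiffS (leq_trans (size_polyD _ _)) // geq_max size_polyXn leqnn andbT.
apply: leq_trans (size_polyMleq _ _) _.
rewrite -[n.+1]/((2 + n).-1) -!subn1 leq_sub2r ?leq_add //.
rewrite (leq_trans (size_polyD _ _)) // geq_max (leq_trans (size_scale_leq _ _)) ?size_polyX //.
by rewrite (leq_trans (size_polyC_leq1 _)).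
Qed.

(** Sum [ostir_divdiff] over k; as the index [n.+1] is positive, the term k = 0 of F vanishes. *)
Lemma ofubini_divdiff n : umbral ofubini (divdiff n.+1) = ofubini n.+1.
Proof.
rewrite [RHS]/ofubini big_ord_recl add0r.
under [RHS]eq_bigr => k _ do rewrite lift0 ostir_divdiff.
rewrite (umbral_wide _ (size_divdiff _)).
under [RHS]eq_bigr => k _ do rewrite (umbral_wide _ (size_divdiff _)).
rewrite exchange_big; apply: eq_bigr => i _ /=.
by rewrite -big_distrr -ofubini_wide.
Qed.

End OrderedStirling.

(** * Words and their statistics *)

Lemma lift_perm_inj2 n (i : 'I_n.+1) :
  injective (fun vs : 'I_n.+1 * 'S_n => lift_perm i vs.1 vs.2).
Proof.
move=> [v s] [w t] /= eq_st.
have eq_vw: v = w by rewrite -(lift_perm_id i v s) eq_st lift_perm_id.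
congr (_, _) => //; apply/permP => k; apply: (@lift_inj _ v).
by rewrite -(lift_perm_lift i) eq_st lift_perm_lift eq_vw.
Qed.

(** Each permutation arises once, by injectivity and counting. With [i] last, this appends a letter;
    the inverse form below inserts a given letter in all places. *)
Lemma big_lift_perm (T : nmodType) n (i : 'I_n.+1) (F : 'S_n.+1 -> T) :
  \sum_s F s = \sum_s \sum_v F (lift_perm i v s).
Proof.
rewrite exchange_big pair_bigA; apply: reindex; apply: onW_bij.
apply: inj_card_bij; first exact: lift_perm_inj2.
by rewrite card_prod card_ord !card_Sn factS.
Qed.

Lemma big_lift_permV (T : nmodType) n (v : 'I_n.+1) (F : 'S_n.+1 -> T) :
  \sum_s F s = \sum_s \sum_i F (lift_perm i v s).
Proof.
rewrite (reindex_inj invg_inj) (big_lift_perm v) (reindex_inj invg_inj).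
by apply: eq_bigr => s _; apply: eq_bigr => i _; rewrite lift_permV invgK.
Qed.

Section Word.
Variable n : nat.
Implicit Type s : 'S_n.

(** Total on [nat], with default value 0, so that neighbouring positions and words of different
    lengths need no casts. *)
Definition word s (i : nat) : nat :=
  if insub i is Some j then val (s j) else 0%N.

Lemma wordE s (i : 'I_n) : word s i = s i.
Proof. by rewrite /word valK. Qed.

Lemma sum_word s (F : nat -> nat) :
  (\sum_(i < n) F (word s i) = \sum_(i < n) F i)%N.
Proof.
rewrite [RHS](reindex_inj (@perm_inj _ s)).
by apply: eq_bigr => i _; rewrite wordE.
Qed.

Lemma word_lt s i : (i < n)%N -> (word s i < n)%N.
Proof. by move=> lt_in; rewrite -[i]/(val (Ordinal lt_in)) wordE. Qed.

End Word.

Lemma word_lift n (p v : 'I_n.+1) (s : 'S_n) i :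
  (i < n)%N -> word (lift_perm p v s) (bump p i) = bump v (word s i).
Proof.
move=> lt_in; rewrite -[i]/(val (Ordinal lt_in)) -[bump _ _]/(val (lift _ _)) !wordE.
by rewrite lift_perm_lift.
Qed.

Lemma word_lift_id n (p v : 'I_n.+1) (s : 'S_n) : word (lift_perm p v s) p = v.
Proof. by rewrite wordE lift_perm_id. Qed.

Lemma sum_geq n v : (\sum_(i < n) (v <= i) = n - v)%N.
Proof.
elim: n => [|n IHn]; first by rewrite big_ord0.
rewrite big_ord_recr IHn /=; case: leqP => [/subSn -> | lt_nv]; first by rewrite addn1.
by rewrite addn0 (eqP (ltnW lt_nv)) (eqP lt_nv).
Qed.

(** The Lehmer code of [w], with positions counted from 0. *)
Definition box (w : nat -> nat) (j : nat) : nat := (\sum_(i < j) (w j < w i))%N.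

Definition winv (w : nat -> nat) (n : nat) : nat := (\sum_(j < n) box w j)%N.

(** All letters greater than the last one precede it. *)
Lemma box_last n (s : 'S_n.+1) : box (word s) n = (n - word s n)%N.
Proof.
have := sum_word s (leq (word s n).+1); rewrite sum_geq big_ord_recr /= ltnn addn0.
by rewrite subSS.
Qed.

Lemma ltn_bump h i j : (bump h i < bump h j)%N = (i < j)%N.
Proof. by rewrite !ltnNge leq_bump2. Qed.

(** * Appending a last letter *)

Section AppendLetter.
Variables (n : nat) (v : 'I_n.+2) (s : 'S_n.+1).
Let t := lift_perm ord_max v s.

Lemma word_append i : (i <= n)%N -> word t i = bump v (word s i).
Proof. by move=> le_in; rewrite -(word_lift ord_max) // /bump leqNgt ltnS le_in. Qed.

Lemma word_append_last : word t n.+1 = v.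
Proof. exact: word_lift_id. Qed.

Lemma word_append_lt i j : (i <= n)%N -> (j <= n)%N ->
  (word t i < word t j)%N = (word s i < word s j)%N.
Proof. by move=> le_in le_jn; rewrite !word_append // ltn_bump. Qed.

Lemma box_append j : (j <= n)%N -> box (word t) j = box (word s) j.
Proof.
move=> le_jn; apply: eq_bigr => i _.
by rewrite word_append_lt // ltnW // (leq_trans (ltn_ord i)).
Qed.

Lemma box_append_last : box (word t) n.+1 = (n.+1 - v)%N.
Proof. by rewrite box_last word_append_last. Qed.

Lemma winv_append : winv (word t) n.+2 = (winv (word s) n.+1 + (n.+1 - v))%N.
Proof.
rewrite /winv big_ord_recr /= box_append_last; congr (_ + _)%N.
by apply: eq_bigr => i _; apply: box_append; rewrite -ltnS.
Qed.

(** By [box_last] both differences are code letters: a descent is a strict increase in the Lehmer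
    code. *)
Lemma des_append_last : (word t n.+1 < word t n)%N = (n - word s n < n.+1 - v)%N.
Proof.
rewrite word_append_last word_append // /bump.
have := word_lt s (ltnSn n); have := ltn_ord v.
by case: (leqP v) => /=; lia.
Qed.

End AppendLetter.

(** * Inversions *)

Section InversionSums.
Variables (R : comNzRingType) (q p z : R).
Hypothesis qp1 : q * p = 1.

Definition desw (w : nat -> nat) n : R :=
  q ^+ winv w n.+1 * \prod_(i < n | (w i.+1 < w i)%N) (1 + p ^+ (1 + box w i) * z).

Definition ascw (w : nat -> nat) n : R :=
  q ^+ winv w n.+1 * \prod_(i < n | (w i < w i.+1)%N) (1 + p ^+ box w i.+1 * z).

Notation L := (umbral (ofubini q z)).
Notation h := (divdiff q z).

Lemma desw_append n (v : 'I_n.+2) (s : 'S_n.+1) :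
  desw (word (lift_perm ord_max v s)) n.+1 = desw (word s) n * (q ^+ (n.+1 - v) *
    (1 + (p ^+ (n - word s n).+1 * z) *+ (n - word s n < n.+1 - v)%N)).
Proof.
rewrite /desw winv_append exprD big_mkcond big_ord_recr /= des_append_last.
rewrite box_append // box_last add1n [in RHS]big_mkcond /=.
set P := \prod_(i < n) _; set Q := \prod_(i < n) _.
have ->: P = Q.
  apply: eq_bigr => i _; rewrite word_append_lt ?box_append //; exact: ltnW.
by case: ifP => _ /=; ring.
Qed.

Lemma ascw_append n (v : 'I_n.+2) (s : 'S_n.+1) :
  ascw (word (lift_perm ord_max v s)) n.+1 = ascw (word s) n * (q ^+ (n.+1 - v) *
    (1 + (p ^+ (n.+1 - v) * z) *+ (n.+1 - v <= n - word s n)%N)).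
Proof.
rewrite /ascw winv_append exprD big_mkcond big_ord_recr /= box_append_last.
(* [bump v] never takes the value [v], so adjacent letters differ and an ascent is a non-descent. *)
have ->: (word (lift_perm ord_max v s) n < word (lift_perm ord_max v s) n.+1)%N =
    (n.+1 - v <= n - word s n)%N.
  rewrite [RHS]leqNgt -des_append_last -leqNgt ltn_neqAle word_append // word_append_last.
  by rewrite eq_sym neq_bump.
rewrite [in RHS]big_mkcond /=.
set P := \prod_(i < n) _; set Q := \prod_(i < n) _.
have ->: P = Q.
  by apply: eq_bigr => i _; rewrite word_append_lt ?box_append // ltnW.
by case: ifP => _ /=; ring.
Qed.

(** The test function [g] separates words by their last code letter, on which the factor of the next
    letter depends; this is what the induction on length requires. *)
Lemma sum_desw n (g : nat -> R) :
  \sum_(s : 'S_n.+1) desw (word s) n * g (n - word s n)%N =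
  \sum_(c < n.+1) L ('X^(n - c) * (q *: 'X + z%:P) ^+ c) * g c.
Proof.
elim: n g => [|n IHn] g.
  rewrite (big_pred1 1%g) => [|s]; last by rewrite /= [s]permS1 eqxx.
  rewrite big_ord_recl big_ord0 addr0 mulr1 umbralXn /ofubini big_ord_recl big_ord0.
  by rewrite /desw /winv big_ord0 /= !big_ord_recl !big_ord0 /box big_ord0 !expr0 !mulr1 addr0.
rewrite (big_lift_perm ord_max).
under eq_bigr => s _.
  under eq_bigr => v _ do rewrite desw_append word_append_last -mulrA.
  (* Sum over the new code letter c = n + 1 - v instead of v. *)
  rewrite -big_distrr /= (reindex_inj rev_ord_inj) /=.
  under eq_bigr => c _ do rewrite subSS (subKn (leq_ord c)).
  over.
(* The inner sum over c is a test function of the previous code letter d. *)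
rewrite (IHn (fun d => \sum_(c < n.+2) q ^+ c * (1 + (p ^+ d.+1 * z) *+ (d < c)%N) * g c)).
under eq_bigr => d _ do rewrite big_distrr /=.
rewrite exchange_big; apply: eq_bigr => c _ /=.
under eq_bigr => d _ do rewrite mulrA mulrCA.
rewrite -big_distrl -big_distrr; congr (_ * _) => /=.
case: c => c /=; rewrite ltnS.
(* The coefficients of [g c] are compared by induction on c. For c = 0 this is L(h_(n+1)) = F_(n+1);
   the step splits one factor qx + z: its part qx gives q times the case c, its part z the new term
   d = c. *)
elim: c => [|c IHc] le_cn.
  under eq_bigr => d _ do rewrite mulr0n addr0 mulr1.
  rewrite subn0 !expr0 mul1r mulr1 umbralXn -ofubini_divdiff -umbral_sum /divdiff.
  by congr umbral; apply: eq_bigr => i _.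
pose T d := L ('X^(n - d) * (q *: 'X + z%:P) ^+ d).
have ->: \sum_(d < n.+1) T d * (1 + (p ^+ d.+1 * z) *+ (d < c.+1)%N) =
    \sum_(d < n.+1) T d * (1 + (p ^+ d.+1 * z) *+ (d < c)%N) + T c * (p ^+ c.+1 * z).
  rewrite (bigD1 (Ordinal le_cn)) //= [in RHS](bigD1 (Ordinal le_cn)) //=.
  rewrite ltnSn ltnn addrAC -mulrDr addr0; congr (_ + _).
  by apply: eq_bigr => d; rewrite ltnS [(d <= c)%N]leq_eqVlt => /negPf; rewrite -val_eqE /= => ->.
rewrite mulrDr {1}exprS -mulrA IHc ?(ltnW le_cn) //.
have qpc: q ^+ c.+1 * p ^+ c.+1 = 1 by rewrite -exprMn qp1 expr1n.
have ->: q ^+ c.+1 * (T c * (p ^+ c.+1 * z)) = z * T c.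
  by rewrite -[RHS]mul1r -qpc; ring.
rewrite -!umbralZ -umbralD subSS; congr umbral.
rewrite (subSn (le_cn : (c <= n)%N)) !exprS -!mul_polyC; ring.
Qed.

(** The sum telescopes, because x^d h_(n+1-d) = q x^(d+1) h_(n-d) + z x^d h_(n-d) + x^n; the last
    boundary term vanishes, as h_0 = 0. *)
Lemma sum_ascw_tail n c : (c <= n.+1)%N ->
  \sum_(d < n.+1) (q ^+ d * (ofubini q z n + z * L ('X^d * h (n - d)))) *+ (c <= d)%N =
  q ^+ c * L ('X^c * h (n.+1 - c)).
Proof.
pose B d := q ^+ d * (ofubini q z n + z * L ('X^d * h (n - d))).
pose T d := q ^+ d * L ('X^d * h (n.+1 - d)).
have TB d : (d <= n)%N -> B d = T d - T d.+1.
  move=> le_dn; rewrite /B /T subSS (subSn le_dn) divdiffS.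
  have Xn: 'X^n = 'X^d * 'X^(n - d) :> {poly R} by rewrite -exprD subnKC.
  have ->: 'X^d * ((q *: 'X + z%:P) * h (n - d) + 'X^(n - d)) =
      q *: ('X^(d.+1) * h (n - d)) + z *: ('X^d * h (n - d)) + 'X^n.
    by rewrite Xn exprS -!mul_polyC; ring.
  by rewrite !umbralD !umbralZ umbralXn [q ^+ d.+1]exprS; ring.
move=> le_c; rewrite -(big_mkord xpredT (fun d => B d *+ (c <= d)%N)).
rewrite (big_cat_nat (leq0n c) le_c) //= big_nat big1 => [|d /andP[_ lt_dc]]; last by rewrite leqNgt lt_dc.
rewrite add0r (telescope_sumr_eq (fun d => - T d)) => // [|d /andP[le_cd lt_dn]].
  by rewrite {1}/T subnn /divdiff big_ord0 mulr0 umbral0 mulr0 oppr0 add0r opprK.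
by rewrite le_cd TB // opprK addrC.
Qed.

Lemma sum_ascw_total n :
  \sum_(d < n.+1) q ^+ d * (ofubini q z n + z * L ('X^d * h (n - d))) = ofubini q z n.+1.
Proof.
rewrite -ofubini_divdiff -[divdiff _ _ _]mul1r -[RHS]mul1r -(expr0 'X) -(expr0 q).
by rewrite -[in RHS](subn0 n.+1) -sum_ascw_tail.
Qed.

(** The scheme of [sum_desw], with the transition condition c <= d in place of d < c. *)
Lemma sum_ascw n (g : nat -> R) :
  \sum_(s : 'S_n.+1) ascw (word s) n * g (n - word s n)%N =
  \sum_(c < n.+1) q ^+ c * (ofubini q z n + z * L ('X^c * h (n - c))) * g c.
Proof.
elim: n g => [|n IHn] g.
  rewrite (big_pred1 1%g) => [|s]; last by rewrite /= [s]permS1 eqxx.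
  rewrite big_ord_recl big_ord0 addr0 expr0 !mul1r /divdiff big_ord0 umbral0 mulr0 addr0.
  rewrite /ofubini big_ord_recl big_ord0.
  by rewrite /ascw /winv big_ord0 /= !big_ord_recl !big_ord0 /box big_ord0 !expr0 !mulr1 addr0.
rewrite (big_lift_perm ord_max).
under eq_bigr => s _.
  under eq_bigr => v _ do rewrite ascw_append word_append_last -mulrA.
  rewrite -big_distrr /= (reindex_inj rev_ord_inj) /=.
  under eq_bigr => c _ do rewrite subSS (subKn (leq_ord c)).
  over.
rewrite (IHn (fun d => \sum_(c < n.+2) q ^+ c * (1 + (p ^+ c * z) *+ (c <= d)%N) * g c)).
under eq_bigr => d _ do rewrite big_distrr /=.
rewrite exchange_big; apply: eq_bigr => c _ /=.
under eq_bigr => d _ do rewrite mulrA mulrCA.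
rewrite -big_distrl -big_distrr; congr (_ * _) => /=; congr (_ * _).
case: c => c /=; rewrite ltnS => le_cn.
(* The summand 1 gives F_(n+1); the other one gives the tail sum, whose q^c cancels p^c. *)
under eq_bigr => d _ do rewrite mulrDr mulr1.
rewrite big_split /=; congr (_ + _).
  exact: sum_ascw_total.
transitivity (p ^+ c * z * (q ^+ c * L ('X^c * h (n.+1 - c)))).
  rewrite -sum_ascw_tail // big_distrr /=; apply: eq_bigr => d _.
  by case: (c <= d)%N; rewrite ?mulr0n ?mulr0 // mulrC.
have pqc: p ^+ c * q ^+ c = 1 by rewrite mulrC -exprMn qp1 expr1n.
by rewrite mulrACA pqc mul1r.
Qed.

Lemma sum_desw_ofubini n : \sum_(s : 'S_n.+1) desw (word s) n = ofubini q z n.+1.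
Proof.
under eq_bigr => s _ do rewrite -[desw _ _]mulr1.
rewrite (sum_desw _ (fun=> 1)) -ofubini_divdiff /divdiff umbral_sum.
by apply: eq_bigr => c _; rewrite mulr1.
Qed.

Lemma sum_ascw_ofubini n : \sum_(s : 'S_n.+1) ascw (word s) n = ofubini q z n.+1.
Proof.
under eq_bigr => s _ do rewrite -[ascw _ _]mulr1.
rewrite (sum_ascw _ (fun=> 1)) -sum_ascw_total.
by apply: eq_bigr => c _; rewrite mulr1.
Qed.

End InversionSums.

(** * Insertion of the largest letter *)

Definition descent (w : nat -> nat) (i : nat) : bool := (w i.+1 < w i)%N.

(** The bounds allow counting only the descents to the right of an insertion, which are the ones
    that move. *)
Definition wdes (w : nat -> nat) (a b : nat) : nat := (\sum_(a <= i < b) descent w i)%N.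

Definition wmaj (w : nat -> nat) (n : nat) : nat := (\sum_(0 <= i < n) descent w i * i.+1)%N.

Section InsertMax.
Variables (n : nat) (p : 'I_n.+2) (s : 'S_n.+1).
Let t := lift_perm p ord_max s.

Lemma word_insert_lt i : (i < p)%N -> word t i = word s i.
Proof.
move=> lt_ip; have lt_in: (i < n.+1)%N by rewrite (leq_trans lt_ip) // -ltnS.
have := word_lift p ord_max s lt_in; rewrite /bump leqNgt lt_ip add0n => ->.
by rewrite leqNgt word_lt.
Qed.

Lemma word_insert_gt i : (p <= i <= n)%N -> word t i.+1 = word s i.
Proof.
case/andP=> le_pi le_in; have := word_lift p ord_max s (le_in : (i < n.+1)%N).
by rewrite /bump le_pi /= => ->; rewrite leqNgt word_lt.
Qed.

Lemma word_insert_max : word t p = n.+1.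
Proof. exact: word_lift_id. Qed.

Lemma descent_insert_before i : (i.+1 < p)%N -> descent (word t) i = descent (word s) i.
Proof. by move=> lt_ip; rewrite /descent !word_insert_lt // ltnW. Qed.

Lemma descent_insert_pred i : i.+1 = p -> descent (word t) i = false.
Proof.
move=> ip; rewrite /descent ip word_insert_max word_insert_lt -?ip //.
by rewrite ltnNge ltnW // word_lt // -ltnS ip.
Qed.

Lemma descent_insert_at : (p <= n)%N -> descent (word t) p.
Proof.
by move=> le_pn; rewrite /descent word_insert_max word_insert_gt ?leqnn ?word_lt.
Qed.

Lemma descent_insert_after i : (p <= i < n)%N -> descent (word t) i.+1 = descent (word s) i.
Proof.
case/andP=> le_pi lt_in; rewrite /descent !word_insert_gt ?le_pi ?(ltnW lt_in) //.
by rewrite lt_in leqW.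
Qed.

(** The insertion destroys a descent at p - 1, if any, creates one at p and shifts the later ones by
    one. Lost terms stand on the left to avoid subtraction in [nat]; [f] will be 1 for the number of
    descents and [succn] for the major index. *)
Lemma sum_descent_insert (f : nat -> nat) : (p <= n)%N ->
  (\sum_(0 <= i < n.+1) descent (word t) i * f i + (0 < p) * (descent (word s) p.-1 * f p.-1)
     + \sum_(p <= i < n) descent (word s) i * f i =
   \sum_(0 <= i < n) descent (word s) i * f i + f p + \sum_(p <= i < n) descent (word s) i * f i.+1)%N.
Proof.
move=> le_pn.
have after: (\sum_(p <= i < n.+1) descent (word t) i * f i =
    f p + \sum_(p <= i < n) descent (word s) i * f i.+1)%N.
  rewrite big_ltn ?ltnS // descent_insert_at // mul1n big_add1 /=; congr addn.
  by apply: eq_big_nat => i le_pin; rewrite descent_insert_after.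
rewrite (big_cat_nat (leq0n p) (leqW le_pn)) after.
rewrite [X in _ = (X + _ + _)%N](big_cat_nat (leq0n p) le_pn) /=.
have: (\sum_(0 <= i < p) descent (word t) i * f i + (0 < p) * (descent (word s) p.-1 * f p.-1) =
       \sum_(0 <= i < p) descent (word s) i * f i)%N; last by lia.
move: descent_insert_before descent_insert_pred.
case: (nat_of_ord p) => [|m] before at_pred; first by rewrite !big_geq.
rewrite !big_nat_recr //= at_pred // mul0n addn0 mul1n; congr addn.
by apply: eq_big_nat => i /andP[_ lt_im]; rewrite before.
Qed.

Lemma sum_descent_insert_last (f : nat -> nat) : p = n.+1 :> nat ->
  (\sum_(0 <= i < n.+1) descent (word t) i * f i = \sum_(0 <= i < n) descent (word s) i * f i)%N.
Proof.
move=> pn; rewrite big_nat_recr //= descent_insert_pred ?pn // mul0n addn0.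
by apply: eq_big_nat => i /andP[_ lt_in]; rewrite descent_insert_before // pn.
Qed.

Lemma wdes_insert : (p <= n)%N ->
  (wdes (word t) 0 n.+1 + ((0 < p) && descent (word s) p.-1) = (wdes (word s) 0 n).+1)%N.
Proof.
move=> le_pn; have := sum_descent_insert (fun=> 1%N) le_pn; rewrite /wdes.
under eq_bigr do rewrite muln1; under [X in _ = (X + _ + _)%N]eq_bigr do rewrite muln1.
by rewrite muln1 mulnb; lia.
Qed.

Lemma wmaj_insert : (p <= n)%N ->
  (wmaj (word t) n.+1 + ((0 < p) && descent (word s) p.-1) * p =
   wmaj (word s) n + p.+1 + wdes (word s) p n)%N.
Proof.
move=> le_pn; have := sum_descent_insert succn le_pn; rewrite /wmaj /wdes.
have ->: (\sum_(p <= i < n) descent (word s) i * i.+2 =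
    \sum_(p <= i < n) descent (word s) i * i.+1 + \sum_(p <= i < n) descent (word s) i)%N.
  by rewrite -big_split; apply: eq_bigr => i _ /=; rewrite mulnS addnC.
have ->: ((0 < p) * (descent (word s) p.-1 * p.-1.+1) = ((0 < p) && descent (word s) p.-1) * p)%N.
  by case: (nat_of_ord p) => [|m] //=; rewrite mul1n.
by lia.
Qed.

Lemma wdes_insert_last : p = n.+1 :> nat -> wdes (word t) 0 n.+1 = wdes (word s) 0 n.
Proof.
move=> pn; have := sum_descent_insert_last (fun=> 1%N) pn; rewrite /wdes.
by under eq_bigr do rewrite muln1; under [X in _ = X]eq_bigr do rewrite muln1.
Qed.

Lemma wmaj_insert_last : p = n.+1 :> nat -> wmaj (word t) n.+1 = wmaj (word s) n.
Proof. exact: sum_descent_insert_last. Qed.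

End InsertMax.

(** * The major index *)

Section MajorSum.
Variables (R : comNzRingType) (q p z : R).
Hypothesis qp1 : q * p = 1.

Definition zprod (d : nat) : R := \prod_(1 <= j < d.+1) (1 + p ^+ j * z).

Definition majw (w : nat -> nat) n : R := q ^+ wmaj w n * zprod (wdes w 0 n).

Lemma zprodS d : zprod d.+1 = zprod d * (1 + p ^+ d.+1 * z).
Proof. by rewrite /zprod big_nat_recr. Qed.

Lemma exp_zprodS d : q ^+ d.+1 * zprod d.+1 = (q ^+ d.+1 + z) * zprod d.
Proof.
have qpd: q ^+ d.+1 * p ^+ d.+1 = 1 by rewrite -exprMn qp1 expr1n.
by rewrite zprodS -[in RHS](mul1r z) -[in 1 * z]qpd; ring.
Qed.

(** With d descents in [s], the end and the places just after a descent keep d and raise the major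
    index by 0, ..., d; the other places create a descent and raise it by d + 1, ..., n + 1. Both
    geometric sums telescope under q - 1. *)
Lemma sum_majw_insert n (s : 'S_n.+1) :
  (q - 1) * \sum_(v < n.+2) majw (word (lift_perm v ord_max s)) n.+1 =
  q ^+ wmaj (word s) n * (q ^+ n.+2 * zprod (wdes (word s) 0 n).+1
                          - (1 + z) * zprod (wdes (word s) 0 n)).
Proof.
set M := wmaj _ _; set d := wdes _ _ _; pose e m := wdes (word s) m n.
pose G v := majw (word (lift_perm (inord v : 'I_n.+2) ord_max s)) n.+1.
(* Among the places up to m, the first term collects the insertions that create a descent, the
   second those that do not. *)
have partial m : (m <= n)%N -> (q - 1) * \sum_(v < m.+1) G v =
    q ^+ M * ((q ^+ (m.+2 + e m) - q ^+ d.+1) * zprod d.+1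
              + (q ^+ d.+1 - q ^+ (e m).+1) * zprod d).
  elim: m => [|m IHm] le_mn.
    rewrite big_ord1 /G /majw; set v := inord 0.
    have v0: v = 0%N :> nat by rewrite inordK.
    have le_vn: (v <= n)%N by rewrite v0.
    have := wdes_insert s le_vn; have := wmaj_insert s le_vn.
    rewrite v0 /= !addn0 -/d -/M => -> ->.
    by rewrite -/d /e -/d !exprD [q ^+ d.+1]exprS; ring.
  rewrite big_ord_recr mulrDr /= (IHm (ltnW le_mn)) /G /majw; set v := inord _.
  have vm: v = m.+1 :> nat by rewrite inordK // ltnS ltnW.
  have le_vn: (v <= n)%N by rewrite vm.
  have := wdes_insert s le_vn; have := wmaj_insert s le_vn.
  have em: e m = (descent (word s) m + e m.+1)%N by rewrite /e /wdes big_ltn.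
  rewrite vm /= -/d -/M -/(e m.+1) em; case: (descent _ m) => /=.
    rewrite mul1n addn1 => maj_t [->].
    have {maj_t} ->: wmaj (word (lift_perm v ord_max s)) n.+1 = (M + (e m.+1).+1)%N by lia.
    by rewrite add1n !(addnS, addSn) !exprS !exprD; ring.
  by rewrite !addn0 add0n => -> ->; rewrite !(addnS, addSn) !exprS !exprD; ring.
have ->: \sum_(v < n.+2) majw (word (lift_perm v ord_max s)) n.+1 =
    \sum_(v < n.+1) G v + q ^+ M * zprod d.
  rewrite big_ord_recr /=; congr (_ + _).
    apply: eq_bigr => v _; rewrite /G; congr (majw (word (lift_perm _ _ _)) _).
    by apply: val_inj; rewrite /= inordK // ltnW // ltnS.
  by rewrite /majw wdes_insert_last // wmaj_insert_last.
(* At m = n no descents remain to the right; the end is accounted for separately. *)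
rewrite mulrDr partial // /e /wdes big_geq // addn0.
transitivity (q ^+ M * (q ^+ n.+2 * zprod d.+1 - q ^+ d.+1 * zprod d.+1
   + (q ^+ d.+1 - q) * zprod d + (q - 1) * zprod d)); first by ring.
by rewrite exp_zprodS; ring.
Qed.

(* [dil] stands for the substitution z := z / q. *)
Variable dil : {rmorphism R -> R}.
Hypotheses (dilq : dil q = q) (dilp : dil p = p) (dilz : dil z = p * z).
Hypothesis regq : GRing.lreg (q - 1).

(** The substitution turns the factors 1, ..., d into the factors 2, ..., d + 1, and q + z = q (1 +
    z/q) supplies the first one. *)
Lemma dil_zprod d : (q + z) * dil (zprod d) = q * zprod d.+1.
Proof.
elim: d => [|d IHd].
  by rewrite /zprod big_geq // big_nat1 rmorph1 expr1 mulrDr mulrA qp1; ring.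
rewrite [in LHS]zprodS [zprod d.+2]zprodS rmorphM mulrA IHd.
rewrite rmorphD rmorph1 rmorphM rmorphXn dilp dilz [p ^+ d.+2]exprSr; ring.
Qed.

(** [ostir n k] is homogeneous of degree n - k in z; powers of q are placed so as to avoid negative
    exponents. *)
Lemma dil_ostir n k : q ^+ n * dil (ostir q z n k) = q ^+ k * ostir q z n k.
Proof.
elim: n k => [|n IHn] [|k] /=; rewrite ?rmorph0 ?rmorph1 ?mulr0 //.
have dilqk: dil (\sum_(i < k.+1) q ^+ i) = \sum_(i < k.+1) q ^+ i.
  by rewrite rmorph_sum; apply: eq_bigr => i _; rewrite /= rmorphXn dilq.
rewrite rmorphM dilqk rmorphD rmorphM dilz.
set qk := \sum_(i < _) _.
transitivity (qk * ((q * p) * z * (q ^+ n * dil (ostir q z n k.+1))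
                    + q * (q ^+ n * dil (ostir q z n k)))); first by rewrite exprS; ring.
by rewrite qp1 !IHn !exprS; ring.
Qed.

(** Multiplying the recurrence by q - 1 replaces [k+1]_q by q^(k+1) - 1, and [dil_ostir] absorbs the
    powers of q. *)
Lemma ofubini_dil n : (q - 1) * ofubini q z n.+1 =
  (q + z) * (q ^+ n * dil (ofubini q z n)) - (1 + z) * ofubini q z n.
Proof.
have ->: q ^+ n * dil (ofubini q z n) = \sum_(k < n.+1) q ^+ k * ostir q z n k.
  by rewrite rmorph_sum big_distrr; apply: eq_bigr => k _; exact: dil_ostir.
(* In the parts multiplied by z the index is shifted by one; the two terms of index 0 cancel. *)
have F0: ofubini q z n = \sum_(k < n.+1) ostir q z n k.+1 + ostir q z n 0.
  by rewrite (ofubini_wide _ _ (ltnW (ltnSn n.+1))) big_ord_recl addrC.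
have F1: ofubini q z n = \sum_(k < n.+1) ostir q z n k by [].
have qF0: \sum_(k < n.+1) q ^+ k * ostir q z n k =
    \sum_(k < n.+1) q ^+ k.+1 * ostir q z n k.+1 + ostir q z n 0.
  have <- : \sum_(k < n.+2) q ^+ k * ostir q z n k = \sum_(k < n.+1) q ^+ k * ostir q z n k.
    by rewrite big_ord_recr /= ostir_gt // mulr0 addr0.
  by rewrite big_ord_recl expr0 mul1r addrC.
have qF1: q * \sum_(k < n.+1) q ^+ k * ostir q z n k =
    \sum_(k < n.+1) q ^+ k.+1 * ostir q z n k.
  by rewrite big_distrr; apply: eq_bigr => k _ /=; rewrite exprS mulrA.
rewrite [(q + z) * _]mulrDl qF1 qF0 [(1 + z) * _]mulrDl mul1r {1}F1 F0 /ofubini big_ord_recl /= add0r.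
transitivity (\sum_(k < n.+1) ((q ^+ k.+1 - 1) * (z * ostir q z n k.+1 + ostir q z n k))).
  rewrite big_distrr; apply: eq_bigr => k _ /=.
  by rewrite subrX1 mulrA.
transitivity (\sum_(k < n.+1) (q ^+ k.+1 * ostir q z n k)
  + z * \sum_(k < n.+1) (q ^+ k.+1 * ostir q z n k.+1)
  - \sum_(k < n.+1) ostir q z n k - z * \sum_(k < n.+1) ostir q z n k.+1); last by ring.
rewrite !big_distrr -big_split -!sumrB /=.
by apply: eq_bigr => k _; ring.
Qed.

(** By [dil_zprod], the insertion formula summed over [s] is the recurrence [ofubini_dil];
    regularity of q - 1 permits cancelling it. *)
Lemma sum_majw_ofubini n : \sum_(s : 'S_n.+1) majw (word s) n = ofubini q z n.+1.
Proof.
elim: n => [|n IHn].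
  rewrite (big_pred1 1%g) => [|s]; last by rewrite /= [s]permS1 eqxx.
  rewrite /majw /wmaj /wdes /zprod !big_geq // mulr1 expr0.
  by rewrite /ofubini !big_ord_recl !big_ord0 /= !big_ord_recl !big_ord0 /= expr0; ring.
apply: regq; rewrite ofubini_dil -IHn (big_lift_permV ord_max) rmorph_sum.
rewrite !big_distrr -sumrB /=; apply: eq_bigr => s _.
rewrite sum_majw_insert /majw rmorphM rmorphXn dilq.
set d := wdes _ _ _; set M := wmaj _ _.
transitivity (q ^+ M * (q ^+ n.+1 * (q * zprod d.+1) - (1 + z) * zprod d)).
  by rewrite exprSr; ring.
by rewrite -dil_zprod; ring.
Qed.

End MajorSum.

(** * Starred permutations *)

Lemma q_neq0 : q != 0.
Proof. by rewrite /q tofrac_eq0 polyX_eq0. Qed.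

Lemma prod_add_subsets (R : comNzRingType) (I : finType) (A : {set I}) (a : I -> R) :
  \prod_(j in A) (1 + a j) = \sum_(S : {set I} | S \subset A) \prod_(j in S) a j.
Proof.
rewrite big_mkcond /=; under eq_bigr => j _.
  (* Writing the factors outside [A] as 0 + 1 kills all subsets not contained in [A]. *)
  have -> : (if j \in A then 1 + a j else 1) = a j *+ (j \in A) + 1.
    by case: ifP => _; [rewrite addrC | rewrite mulr0n add0r].
  over.
rewrite bigA_distr [RHS]big_mkcond; apply: eq_bigr => S _.
case: ifP => [/subsetP sSA | /subsetPn[j jS jA]].
  by rewrite [RHS]big_mkcond; apply: eq_bigr => j _; case: ifP => // /sSA ->.
by rewrite (bigD1 j) //= jS (negPf jA) mulr0n mul0r.
Qed.

(** Common to both statistics: [m] is the unstarred one and [e s i] what a star at [i] subtracts.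
    Expanding the product over descents chooses the starred set. *)
Lemma sum_starred (K : fieldType) (q : K) (z : {poly K}) (q_neq0 : q != 0)
    n (hn : (0 < n)%N) (m : 'S_n -> nat) (e : 'S_n -> 'I_n -> nat) :
  \sum_(0 <= k < n) (\sum_(x in starred n k)
      q ^ ((m x.1)%:Z - \sum_(i in x.2) (e x.1 i)%:Z)) *: z ^+ k
  = \sum_(s : 'S_n) q ^+ m s *: \prod_(j in Des s) (1 + q ^- (e s j) *: z).
Proof.
under [RHS]eq_bigr => s _ do rewrite prod_add_subsets scaler_sumr.
rewrite pair_big_dep /= big_mkord.
under [LHS]eq_bigr => k _ do rewrite scaler_suml big_mkcond /=.
rewrite [LHS]exchange_big [RHS]big_mkcond /=; apply: eq_bigr => -[s S] _ /=.
under [LHS]eq_bigr => k _ do rewrite inE /=.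
case: ifP => sSD; last by rewrite big1.
(* The last position is never a descent, so the range k < n captures every [S]. *)
have lt_S: (#|S| < n)%N.
  rewrite (leq_ltn_trans (subset_leq_card sSD)) //.
  rewrite -[X in (_ < X)%N]card_ord; apply: (@proper_card _ (Des s) 'I_n); apply/properP; split; first exact/subsetP.
  have lt_n: (n.-1 < n)%N by rewrite prednK.
  by exists (Ordinal lt_n); rewrite // inE /= prednK // ltnn.
rewrite (bigD1 (Ordinal lt_S)) //= eqxx [X in _ + X]big1 ?addr0 => [|k]; last first.
  by rewrite -(inj_eq val_inj) eq_sym => /negPf /= ->.
rewrite scaler_prod prodr_const scalerA /=; congr (_ *: _).
rewrite expfzDr ?q_neq0 //; congr (_ * _).
rewrite (big_morph (fun x => q ^ (- x)) (id1 := 1) (op1 := *%R)) //= => [|x y].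
  by apply: eq_bigr => i _; rewrite exprnN.
by rewrite opprD expfzDr ?q_neq0.
Qed.

(** * From permutation statistics to words *)

Section Translation.
Variable n : nat.
Implicit Type s : 'S_n.+1.

Lemma val_ordS (i : 'I_n.+1) : (i.+1 < n.+1)%N -> ordS i = i.+1 :> nat.
Proof. by move=> lt_in; rewrite /= modn_small. Qed.

Lemma big_Des (T : Type) (idx : T) (op : Monoid.com_law idx) s (F : nat -> T) :
  \big[op/idx]_(i in Des s) F i = \big[op/idx]_(i < n | (word s i.+1 < word s i)%N) F i.
Proof.
rewrite big_mkcond big_ord_recr /= inE ltnn /= Monoid.mulm1 [RHS]big_mkcond.
apply: eq_bigr => i _; rewrite inE /= ltnS ltn_ord /=.
by rewrite -!wordE val_ordS //= ltnS.
Qed.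

Lemma big_Asc (T : Type) (idx : T) (op : Monoid.com_law idx) s (F : nat -> T) :
  \big[op/idx]_(i in Asc s) F i = \big[op/idx]_(i < n | (word s i < word s i.+1)%N) F i.
Proof.
rewrite big_mkcond big_ord_recr /= inE ltnn /= Monoid.mulm1 [RHS]big_mkcond.
apply: eq_bigr => i _; rewrite inE /= ltnS ltn_ord /=.
by rewrite -!wordE val_ordS //= ltnS.
Qed.

Lemma ninv_boxE s j : ninv_box s j = box (word s) j.
Proof.
rewrite /ninv_box /box cardsE -sum1_card big_mkcond /=.
rewrite (big_ord_widen n.+1 (fun i => (word s j < word s i) : nat)%N) ?(ltnW (ltn_ord j)) //.
rewrite [RHS]big_mkcond; apply: eq_bigr => i _; rewrite unfold_in !wordE.
by case: (i < j)%N => //=; case: (_ < _)%N.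
Qed.

Lemma ninvE s : ninv s = winv (word s) n.+1.
Proof.
rewrite /ninv /winv; under [RHS]eq_bigr => j _ do rewrite -ninv_boxE.
rewrite cardsE -sum1_card.
under [RHS]eq_bigr => j _ do rewrite /ninv_box cardsE -sum1_card.
(* The code groups inversions by their second position, hence the swap. *)
rewrite pair_big_dep /= (reindex (fun ij : 'I_n.+1 * 'I_n.+1 => (ij.2, ij.1))) //=.
by exists (fun ij => (ij.2, ij.1)) => -[].
Qed.

Lemma wdesE s a b : wdes (word s) a b = (\sum_(a <= i < b | (word s i.+1 < word s i)%N) 1)%N.
Proof. by rewrite [RHS]big_mkcond; apply: eq_bigr => i _; rewrite /descent; case: (_ < _)%N. Qed.

Lemma majE s : maj s = wmaj (word s) n.
Proof.
rewrite /maj (big_Des _ s succn) big_mkcond /wmaj big_mkord; apply: eq_bigr => i _ /=.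
by rewrite /descent; case: (_ < _)%N; rewrite ?mul1n.
Qed.

Lemma desE s : des s = wdes (word s) 0 n.
Proof. by rewrite /des -sum1_card (big_Des _ s (fun=> 1%N)) wdesE big_mkord. Qed.

Lemma card_Des_geq s (i : 'I_n.+1) : #|[set j in Des s | (i <= j)%N]| = wdes (word s) i n.
Proof.
rewrite cardsE -sum1_card big_mkcondr (big_Des _ s (fun j => if (i <= j)%N then 1%N else 0%N)).
rewrite wdesE (big_nat_widenl i 0) // big_mkord -big_mkcondr /=.
by apply: eq_bigl => j.
Qed.

(** Read from right to left, the descents have ranks 1, 2, ..., [des s]. *)
Lemma prod_Des_rank (R : comNzRingType) s (f : nat -> R) :
  \prod_(i in Des s) f #|[set j in Des s | (i <= j)%N]| = \prod_(1 <= j < (des s).+1) f j.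
Proof.
under eq_bigr => i _ do rewrite card_Des_geq.
rewrite (big_Des _ s (fun i => f (wdes (word s) i n))) desE.
rewrite -(big_mkord (fun i => word s i.+1 < word s i)%N (fun i => f (wdes (word s) i n))).
(* Induction on the length m of a final segment: a descent at its first position has the largest
   rank. *)
suff rank m : (m <= n)%N -> \prod_(n - m <= i < n | (word s i.+1 < word s i)%N)
    f (wdes (word s) i n) = \prod_(1 <= j < (wdes (word s) (n - m) n).+1) f j.
  by have := rank n (leqnn n); rewrite subnn.
elim: m => [|m IHm] lt_mn; first by rewrite subn0 /wdes !big_geq.
have lt_n: (n - m.+1 < n)%N by lia.
have eqS: (n - m.+1).+1 = (n - m)%N by lia.
rewrite big_mkcond big_ltn // -big_mkcond /= eqS (IHm (ltnW lt_mn)).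
have ->: wdes (word s) (n - m.+1) n = (descent (word s) (n - m.+1) + wdes (word s) (n - m) n)%N.
  by rewrite /wdes big_ltn // eqS.
rewrite {1 2}/descent eqS; case: (_ < _)%N; last by rewrite /= mul1r add0n.
by rewrite add1n [RHS]big_nat_recr //= mulrC.
Qed.

End Translation.

(** * The q-Stirling numbers and the final equalities *)

Lemma ostirE n k : (qfact k * qstirling n k) *: z ^+ (n - k) = ostir q%:P z n k.
Proof.
elim: n k => [|n IHn] [|k] //=.
- by rewrite /qfact big_geq // mulr1 expr0 scale1r.
- by rewrite mulr0 scale0r.
- by rewrite add0r /qint big_ord0 mul0r mulr0 scale0r.
rewrite -!IHn subSS.
have ->: \sum_(i < k.+1) q%:P ^+ i = (qint k.+1)%:P :> {poly Zq}.
  by rewrite /qint rmorph_sum; apply: eq_bigr => i _; rewrite rmorphXn.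
have ->: qfact k.+1 = qfact k * qint k.+1 by rewrite /qfact big_nat_recr.
(* When n <= k the truncated exponents disagree, but the Stirling number is 0. *)
have: z * (qfact k * qint k.+1 * qstirling n k.+1 *: z ^+ (n - k.+1)) =
    qfact k * qint k.+1 * qstirling n k.+1 *: z ^+ (n - k).
  have [lt_kn | le_nk] := ltnP k n; first by rewrite -scalerAr -exprS -subSn.
  by rewrite qstirling_gt // mulr0 !scale0r mulr0.
move=> ->; rewrite mul_polyC -scalerDl scalerA.
by congr (_ *: _); ring.
Qed.

Theorem theorem4p2p2 (n : nat) (hn : (1 <= n)%N) :
  [/\ \sum_(0 <= k < n) (\sum_(x in starred n k) q ^ ninv_star x) *: z ^+ k
      = \sum_(0 <= k < n) (\sum_(x in starred n k) q ^ maj_star x) *: z ^+ k,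
      \sum_(0 <= k < n) (\sum_(x in starred n k) q ^ maj_star x) *: z ^+ k
      = \sum_(1 <= k < n.+1) (qfact k * qstirling n k) *: z ^+ (n - k),
      \sum_(1 <= k < n.+1) (qfact k * qstirling n k) *: z ^+ (n - k)
      = \sum_(s : 'S_n) q ^+ ninv s *:
          \prod_(j in Des s) (1 + q ^- (1 + ninv_box s j) *: z),
      \sum_(s : 'S_n) q ^+ ninv s *:
        \prod_(j in Des s) (1 + q ^- (1 + ninv_box s j) *: z)
      = \sum_(s : 'S_n) q ^+ ninv s *:
          \prod_(j in Asc s) (1 + q ^- ninv_box s (ordS j) *: z)
    & \sum_(s : 'S_n) q ^+ ninv s *:
        \prod_(j in Asc s) (1 + q ^- ninv_box s (ordS j) *: z)
      = \sum_(s : 'S_n) q ^+ maj s *: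
          \prod_(1 <= j < (des s).+1) (1 + q ^- j *: z)].
Proof.
have inv_expand : \sum_(0 <= k < n) (\sum_(x in starred n k) q ^ ninv_star x) *: z ^+ k =
    \sum_(s : 'S_n) q ^+ ninv s *: \prod_(j in Des s) (1 + q ^- (1 + ninv_box s j) *: z).
  exact: (sum_starred z q_neq0 hn (@ninv n) (fun s i => (1 + ninv_box s i)%N)).
have maj_expand : \sum_(0 <= k < n) (\sum_(x in starred n k) q ^ maj_star x) *: z ^+ k =
    \sum_(s : 'S_n) q ^+ maj s *: \prod_(1 <= j < (des s).+1) (1 + q ^- j *: z).
  pose e (s : 'S_n) (i : 'I_n) := #|[set j in Des s | (i <= j)%N]|.
  transitivity (\sum_(s : 'S_n) q ^+ maj s *: \prod_(j in Des s) (1 + q ^- (e s j) *: z)).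
    exact: (sum_starred z q_neq0 hn (@maj n) e).
  case: n hn inv_expand @e => // n' _ _ e; apply: eq_bigr => s _; congr (_ *: _).
  exact: (prod_Des_rank s (fun j => 1 + q ^- j *: z)).
case: n hn inv_expand maj_expand => // n _ inv_expand maj_expand.
(* All expressions are compared with F over the ring of polynomials in z, where q and 1/q are
   constants. *)
pose Q : {poly Zq} := q%:P; pose P : {poly Zq} := (q^-1)%:P.
have QP: Q * P = 1 by rewrite -polyCM divff ?q_neq0.
have QE m (r : {poly Zq}) : q ^+ m *: r = Q ^+ m * r by rewrite /Q -polyC_exp mul_polyC.
have PE m : q ^- m *: z = P ^+ m * z by rewrite /P -polyC_exp mul_polyC exprVn.
have stirling_sum : \sum_(1 <= k < n.+2) (qfact k * qstirling n.+1 k) *: z ^+ (n.+1 - k) = ofubini Q z n.+1.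
  rewrite big_add1 big_mkord [RHS]/ofubini [RHS]big_ord_recl -[LHS]add0r.
  by congr (_ + _); apply: eq_bigr => k _; exact: ostirE.
have des_sum : \sum_(s : 'S_n.+1) q ^+ ninv s *:
    \prod_(j in Des s) (1 + q ^- (1 + ninv_box s j) *: z) = ofubini Q z n.+1.
  rewrite -(sum_desw_ofubini z QP n); apply: eq_bigr => s _; rewrite QE ninvE; congr (_ * _).
  under eq_bigr => j _ do rewrite PE ninv_boxE.
  exact: (big_Des _ s (fun j => 1 + P ^+ (1 + box (word s) j) * z)).
have asc_sum : \sum_(s : 'S_n.+1) q ^+ ninv s *:
    \prod_(j in Asc s) (1 + q ^- ninv_box s (ordS j) *: z) = ofubini Q z n.+1.
  rewrite -(sum_ascw_ofubini z QP n); apply: eq_bigr => s _; rewrite QE ninvE; congr (_ * _).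
  rewrite -(big_Asc _ s (fun j => 1 + P ^+ box (word s) j.+1 * z)).
  (* An ascent is not the last position, so [ordS j] does not wrap around. *)
  apply: eq_bigr => j; rewrite inE => /andP[lt_jn _].
  by rewrite PE ninv_boxE val_ordS.
have maj_sum : \sum_(s : 'S_n.+1) q ^+ maj s *:
    \prod_(1 <= j < (des s).+1) (1 + q ^- j *: z) = ofubini Q z n.+1.
  (* The substitution z := z/q is composition with [P * z], which fixes constants. *)
  have dilC (c : Zq) : comp_poly (P * z) c%:P = c%:P by rewrite comp_polyC.
  have dilz : comp_poly (P * z) z = P * z by rewrite comp_polyX.
  have regQ : GRing.lreg (Q - 1).
    (* Over a domain it suffices that q differs from 1, seen on the sizes of X and 1 as integer
       polynomials. *)
    apply/lregP; rewrite -polyC1 -polyCB polyC_eq0 subr_eq0 /q.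
    rewrite -tofrac1 tofrac_eq; apply/eqP => /(congr1 (fun r : {poly int} => size r)).
    by rewrite size_polyX size_poly1.
  rewrite -(sum_majw_ofubini QP (dilC _) (dilC _) dilz regQ n).
  apply: eq_bigr => s _; rewrite QE majE desE; congr (_ * _).
  by apply: eq_bigr => j _; rewrite PE.
split.
- exact: etrans (etrans inv_expand des_sum) (esym (etrans maj_expand maj_sum)).
- exact: etrans (etrans maj_expand maj_sum) (esym stirling_sum).
- exact: etrans stirling_sum (esym des_sum).
- exact: etrans des_sum (esym asc_sum).
- exact: etrans asc_sum (esym maj_sum).
Qed.
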